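(* Let $\varphi\in L^2(\mathbb{R}^2)$ satisfy $\operatorname{supp}(\varphi)\subseteq[N_1,M_1]\times[N_2,M_2]$, suppose that $\{\varphi(\cdot-\boldsymbol{k}):\boldsymbol{k}\in\mathbb{Z}^2\}$ is linearly independent, and assume: (i) the Sobolev smoothness satisfies $\nu_2(\varphi)>1/2$; (ii) $\widehat{\varphi}(\boldsymbol{0})=\int_{\mathbb{R}^2}\varphi(\boldsymbol{x})\,d\boldsymbol{x}\neq0$. Let $f\in V(\varphi,\mathbb{Z}^2)$ be an arbitrary target function with $\operatorname{supp}(f)\subseteq[a_1,b_1]\times[a_2,b_2]$. Let $$E=\big([\lceil a_1-M_1\rceil,\lfloor b_1-N_1\rfloor]\times[\lceil a_2-M_2\rceil,\lfloor b_2-N_2\rfloor]\big)\cap\mathbb{Z}^2,$$ and let $E^+=\emptyset$ if $\#E=1$ and $E^+=\{\boldsymbol{x}-\boldsymbol{y}:\boldsymbol{x}\neq\boldsymbol{y}\in E\}$ if $\#E>1$. Then for any $\boldsymbol{p}\in\{(\cos\theta,\sin\theta):\theta\in[0,2\pi)\}\setminus\mathrm{dv}_{\mathcal{N}_{E^+}}$ there exists a sampling set $X_{\boldsymbol{p}}\subseteq\mathbb{R}$ with $\#X_{\boldsymbol{p}}=\#E$ such that $f$ can be determined by its single-angle Radon samples (with respect to $\boldsymbol{p}$) at $X_{\boldsymbol{p}}$.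
   Context: Vectors in $\mathbb{R}^2$ are columns; a direction vector $\boldsymbol{p}=(\cos\theta,\sin\theta)$ is a row vector. $\mathcal{R}_{\boldsymbol{p}}f(t)=\int_{-\infty}^{\infty}f(t\cos\theta-s\sin\theta,\,t\sin\theta+s\cos\theta)\,ds$. The Fourier transform is $\widehat{g}(\gamma)=\int_{\mathbb{R}^d}g(\boldsymbol{x})e^{-i\boldsymbol{x}\cdot\gamma}d\boldsymbol{x}$. $H^\varsigma(\mathbb{R}^d)=\{g:\int_{\mathbb{R}^d}|\widehat g(\xi)|^2(1+\|\xi\|_2^2)^{\varsigma}d\xi<\infty\}$ and $\nu_2(g)=\sup\{\varsigma:g\in H^\varsigma(\mathbb{R}^d)\}$. $V(\varphi,\mathbb{Z}^2)=\{\sum_{\boldsymbol{k}\in\mathbb{Z}^2}c_{\boldsymbol{k}}\varphi(\cdot-\boldsymbol{k}):\sum_{\boldsymbol{k}}|c_{\boldsymbol{k}}|^2<\infty\}$. For $\mathcal{S}\subseteq\mathbb{R}^2$ with $\mathcal{S}\setminus\{\boldsymbol{0}\}\ne\emptyset$: the direction vector set is $\mathrm{dv}_{\mathcal{S}}=\{(\cos\theta,\sin\theta):\ \boldsymbol{0}\neq\boldsymbol{x}=\|\boldsymbol{x}\|_2(\cos\theta,\sin\theta)^T\in\mathcal{S}\}$, and the null set is $\mathcal{N}_{\mathcal{S}}=\{\boldsymbol{0}\ne\boldsymbol{y}\in\mathbb{R}^2:\text{there is }\boldsymbol{0}\neq\boldsymbol{x}\in\mathcal{S}\text{ with }\boldsymbol{x}^T\boldsymbol{y}=0\}$.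 For $\mathcal{S}=\emptyset$ or $\{\boldsymbol{0}\}$, both sets are defined to be $\emptyset$. Standing convention: a target function $f\in V(\varphi,\mathbb{Z}^2)$ with $\operatorname{supp}(f)\subseteq[a_1,b_1]\times[a_2,b_2]$ is one expressed as $f=\sum_{\boldsymbol{k}\in E}c_{\boldsymbol{k}}\varphi(\cdot-\boldsymbol{k})$ with $c_{\boldsymbol{k}}\in\mathbb{C}$. ''$f$ can be determined by its single-angle Radon samples at $X$'' means that $f$ is the only function $h$ of the form $\sum_{\boldsymbol{k}\in E}d_{\boldsymbol{k}}\varphi(\cdot-\boldsymbol{k})$, $d_{\boldsymbol{k}}\in\mathbb{C}$, with $\mathcal{R}_{\boldsymbol{p}}h(x)=\mathcal{R}_{\boldsymbol{p}}f(x)$ for all $x\in X$. The set $X_{\boldsymbol{p}}$ depends on $\varphi,E,\boldsymbol{p}$ but not on $f$. $\mathcal{R}_{\boldsymbol{p}}\varphi$ agrees almost everywhere with a continuous function under hypothesis (i), and samples are values of the continuous representative. *)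

(* Defs.v *)
From HB Require Import structures.
From mathcomp Require Import all_boot all_order all_algebra.
From mathcomp Require Import complex.
From mathcomp Require Import all_classical all_reals all_analysis.
Set Implicit Arguments.
Unset Strict Implicit.
Unset Printing Implicit Defensive.
Import Order.TTheory GRing.Theory Num.Theory.
Import numFieldNormedType.Exports.
Local Open Scope classical_set_scope.
Local Open Scope ring_scope.
Local Open Scope complex_scope.

(* The plane is [R * R]; functions are complex valued. *)

Definition leb (R : realType) :
    {measure set (measurableTypeR R) -> \bar R} :=
  @lebesgue_measure R.

Definition leb2 (R : realType) :
    {measure set (measurableTypeR R * measurableTypeR R) -> \bar R} :=
  (@lebesgue_measure R \x @lebesgue_measure R)%E.

Definition cabs (R : realType) (z : R[i]) : R := ComplexField.Normc.normc z.

Definition expi (R : realType) (t : R) : R[i] := cos t +i* sin t.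

Definition dot2 (R : realType) (x y : R * R) : R := x.1 * y.1 + x.2 * y.2.

Definition norm2 (R : realType) (x : R * R) : R :=
  Num.sqrt (x.1 ^+ 2 + x.2 ^+ 2).

Definition Cintegral (d : measure_display) (T : measurableType d)
    (R : realType) (mu : {measure set T -> \bar R}) (f : T -> R[i]) : R[i] :=
  Rintegral mu setT (fun x => complex.Re (f x)) +i*
  Rintegral mu setT (fun x => complex.Im (f x)).

Definition inL2 (R : realType) (f : R * R -> R[i]) : Prop :=
  [/\ measurable_fun [set: measurableTypeR R * measurableTypeR R]
        (fun x => complex.Re (f x)),
      measurable_fun [set: measurableTypeR R * measurableTypeR R]
        (fun x => complex.Im (f x)) &
      (\int[leb2 R]_x ((cabs (f x)) ^+ 2)%:E < +oo)%E].

(* Support of an L2 class: the points of which no neighbourhood meets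
   [f != 0] in a null set. *)
Definition supp (R : realType) (f : R * R -> R[i]) : set (R * R) :=
  [set x | forall U : set (R * R), nbhs x U ->
     ~ (leb2 R).-negligible (U `&` [set y | f y != 0])].

Definition box (R : realType) (a1 b1 a2 b2 : R) : set (R * R) :=
  [set x | a1 <= x.1 <= b1 /\ a2 <= x.2 <= b2].

(* The integral converges when [g] is in L1, in particular when [g] is in L2
   with bounded support, the only case in which it is used. *)
Definition fourier2 (R : realType) (g : R * R -> R[i]) (xi : R * R) : R[i] :=
  Cintegral (leb2 R) (fun x => g x * expi (- dot2 x xi)).

Definition inH (R : realType) (s : R) (g : R * R -> R[i]) : Prop :=
  (\int[leb2 R]_xi
     ((cabs (fourier2 g xi)) ^+ 2 * ((1 + norm2 xi ^+ 2) `^ s))%:E < +oo)%E.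

Definition nu2 (R : realType) (g : R * R -> R[i]) : \bar R :=
  ereal_sup [set s%:E | s in [set s : R | inH s g]].

Definition zpt (R : realType) (k : int * int) : R * R :=
  (k.1%:~R, k.2%:~R).

(* [\sum_(k in A) c_k phi(. - k)]; [A] is always finite below. *)
Definition zcomb (R : realType) (A : set (int * int)) (c : int * int -> R[i])
    (phi : R * R -> R[i]) : R * R -> R[i] :=
  fun x => \sum_(k \in A) c k * phi (x - zpt R k).

Definition shifts_independent (R : realType) (phi : R * R -> R[i]) : Prop :=
  forall (A : set (int * int)) (c : int * int -> R[i]), finite_set A ->
    {ae leb2 R, forall x, zcomb A c phi x = 0} -> forall k, A k -> c k = 0.

(* The series over Z^2 is the L2 limit of its finite partial sums. *)
Definition shift_space (R : realType) (phi : R * R -> R[i])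
    (f : R * R -> R[i]) : Prop :=
  inL2 f /\
  exists c : int * int -> R[i],
    (\esum_(k in [set: int * int]) ((cabs (c k)) ^+ 2)%:E < +oo)%E /\
    forall e : R, 0 < e ->
      exists2 A0 : set (int * int), finite_set A0 &
        forall A : set (int * int), finite_set A -> A0 `<=` A ->
          (\int[leb2 R]_x ((cabs (f x - zcomb A c phi x)) ^+ 2)%:E < e%:E)%E.

Definition dirs (R : realType) : set (R * R) :=
  [set p | exists2 theta : R, 0 <= theta < 2 * pi &
     p = (cos theta, sin theta)].

(* When [S] has no nonzero point, [dv S] and [nullset S] are empty. *)
Definition dv (R : realType) (S : set (R * R)) : set (R * R) :=
  [set p | exists (theta : R) (x : R * R),
     [/\ S x, x != 0, x = (norm2 x * cos theta, norm2 x * sin theta) &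
         p = (cos theta, sin theta)]].

Definition nullset (R : realType) (S : set (R * R)) : set (R * R) :=
  [set y | y != 0 /\ exists x : R * R, [/\ S x, x != 0 & dot2 x y = 0]].

Definition radon (R : realType) (p : R * R) (f : R * R -> R[i]) : R -> R[i] :=
  fun t => Cintegral (leb R)
    (fun s => f (t * p.1 - s * p.2, t * p.2 + s * p.1)).

Definition is_cont_rep (R : realType) (g h : R -> R[i]) : Prop :=
  [/\ continuous (fun t => complex.Re (h t)),
      continuous (fun t => complex.Im (h t)) &
      {ae leb R, forall t, h t = g t}].

(* The samples of [radon p f] are the values of its continuous representative,
   which is unique when it exists; [radon p f] itself is only the default
   value in the absence of such a representative. *)
Definition radon_sample (R : realType) (p : R * R) (f : R * R -> R[i]) :
    R -> R[i] :=
  xget (radon p f) [set h | is_cont_rep (radon p f) h].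

Definition Eset (R : realType) (N1 M1 N2 M2 a1 b1 a2 b2 : R) :
    set (int * int) :=
  [set k | Num.ceil (a1 - M1) <= k.1 <= Num.floor (b1 - N1) /\
           Num.ceil (a2 - M2) <= k.2 <= Num.floor (b2 - N2)].

(* Empty when [E] has at most one element. *)
Definition Eplus (R : realType) (E : set (int * int)) : set (R * R) :=
  [set z | exists x y : int * int,
     [/\ E x, E y, x <> y & z = zpt R x - zpt R y]].

Definition target (R : realType) (phi : R * R -> R[i]) (E : set (int * int))
    (a1 b1 a2 b2 : R) (f : R * R -> R[i]) : Prop :=
  [/\ shift_space phi f, supp f `<=` box a1 b1 a2 b2 &
      exists c : int * int -> R[i], f = zcomb E c phi].

Definition determined (R : realType) (phi : R * R -> R[i])
    (E : set (int * int)) (p : R * R) (X : set R) (f : R * R -> R[i]) : Prop :=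
  forall d : int * int -> R[i],
    (forall x, X x ->
       radon_sample p (zcomb E d phi) x = radon_sample p f x) ->
    zcomb E d phi = f.

(* Main.v *)
(* Put [g := radon p phi] and [t_k := dot2 p k].  By Fubini in rotated
   coordinates the Radon transform of [\sum_k c_k phi(. - k)] is almost
   everywhere [\sum_k c_k g(. - t_k)], and the condition on [p] makes the [t_k]
   distinct.  Since [g] vanishes near [-oo] and has integral
   [fourier2 phi 0 != 0], its translates are linearly independent: the leftmost
   one is alone just after the left end of the support.  Hence there are #E
   points, outside any prescribed null set, at which the matrix
   [g(x_i - t_k)] is invertible.
   Whether [g] has a continuous representative plays no role: the coefficient
   vectors whose combination has one form a finite-dimensional subspace, so a
   single null set contains all the points where some sample differs from
   [\sum_k c_k g(x - t_k)]. *)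
Require Import Defs.
From mathcomp Require Import all_boot all_order all_algebra.
From mathcomp Require Import complex.
From mathcomp Require Import all_classical all_reals all_analysis.
From mathcomp Require Import measurable_realfun zify ring lra.
Import Order.TTheory GRing.Theory Num.Theory.
Import numFieldNormedType.Exports.
Local Open Scope classical_set_scope.
Local Open Scope ring_scope.
Set Implicit Arguments.
Unset Strict Implicit.

(** * Measure-preserving maps and change of variables *)

Section measure_preserving.
Context d (T : measurableType d) (R : realType).
Variable mu : {measure set T -> \bar R}.

Definition measure_preserving (h : T -> T) :=
  measurable_fun setT h /\
  forall A, measurable A -> mu (h @^-1` A) = mu A.

Lemma measure_preserving_comp (g h : T -> T) :
  measure_preserving g -> measure_preserving h ->
  measure_preserving (g \o h).
Proof.
move=> [mg pg] [mh ph]; split; first exact: measurableT_comp.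
move=> A mA; rewrite comp_preimage ph ?pg//.
by rewrite -[X in measurable X]setTI; exact: mg.
Qed.

Lemma measure_preserving_ae (h : T -> T) (P : T -> Prop) :
  measure_preserving h -> {ae mu, forall x, P x} ->
  {ae mu, forall x, P (h x)}.
Proof.
move=> [mh ph] [A [mA A0 PA]]; exists (h @^-1` A); split.
- by rewrite -[X in measurable X]setTI; exact: mh.
- by rewrite ph.
- by move=> x /= nP; apply: PA.
Qed.

(** The pushforward of [mu] by [h] is [mu] itself, so the integral of the modulus is unchanged. *)
Lemma measure_preserving_integrable (h : T -> T) (f : T -> \bar R) :
  measure_preserving h -> mu.-integrable setT f ->
  mu.-integrable setT (f \o h).
Proof.
move=> [mh ph] /integrableP[mf f_fin]; apply/integrableP; split.
  exact: (measurableT_comp mf mh).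
apply: le_lt_trans f_fin.
have <- : (\int[pushforward mu h]_x `|f x| = \int[mu]_x `|f x|)%E.
  by apply: eq_measure_integral => A mA _; rewrite /= /pushforward ph.
by rewrite ge0_integral_pushforward//; exact: measurableT_comp.
Qed.

Lemma measure_preserving_integral (h : T -> T) (f : T -> \bar R) :
  measure_preserving h -> mu.-integrable setT f ->
  (\int[mu]_x f (h x) = \int[mu]_x f x)%E.
Proof.
move=> hp fi; have := measure_preserving_integrable hp fi.
case: hp => [mh ph] fhi.
transitivity (\int[pushforward mu h]_x f x)%E.
  by rewrite integral_pushforward//; case/integrableP: fi.
by apply: eq_measure_integral => A mA _; rewrite /= /pushforward ph.
Qed.

End measure_preserving.

(** * Translations, shears and rotations preserve Lebesgue measure *)

Section rotation.
Context (R : realType).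

(** Lebesgue measure is determined by its values on half-open intervals, so comparing lengths there
    suffices. *)
Lemma measure_preserving_translation (a : R) :
  measure_preserving (leb R) (fun x => x + a).
Proof.
have ma : measurable_fun setT (fun x : measurableTypeR R => x + a : R).
  exact: measurable_funD.
split=> // A mA; apply/esym.
apply: (lebesgue_measure_unique (mu := pushforward (leb R)
  (fun x : measurableTypeR R => (x + a : measurableTypeR R)))) => // _ [[u v]] _ <-.
rewrite /= /pushforward.
rewrite (_ : _ @^-1` _ = `](u - a), (v - a)]%classic); last first.
  by apply/seteqP; split=> x /=; rewrite !in_itv/= ltrBlDr lerBrDr.
rewrite /leb/= !lebesgue_measure_itv/= !lte_fin ltrD2r -!EFinB.
by congr (if _ then _%:E else _); ring.
Qed.

Local Notation plane := (measurableTypeR R * measurableTypeR R)%type.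

(** The product measure integrates the measures of the vertical sections, and the shear translates
    the section at [x] by [a * x]. *)
Lemma measure_preserving_shear2 (a : R) :
  measure_preserving (leb2 R) (fun z : plane => (z.1, z.2 + a * z.1)).
Proof.
have ms : measurable_fun setT (fun z : plane => (z.1, z.2 + a * z.1) : plane).
  apply: (measurable_fun_pair (g := fun z : plane => z.2 + a * z.1 : R)) => //.
  by apply: measurable_funD => //; apply: measurable_funM.
split=> // A mA; rewrite /leb2/= /product_measure1.
apply: eq_integral => x _ /=.
rewrite -((measure_preserving_translation (a * x)).2 (xsection A x)) //.
exact: measurable_xsection.
Qed.

(** Gives access to horizontal sections, which the shear of the first coordinate translates. *)
Lemma leb2_swapped (A : set plane) : measurable A ->
  leb2 R A = (@lebesgue_measure R \x^ @lebesgue_measure R)%E A.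
Proof.
move=> mA; apply: product_measure_unique => // B C mB mC.
exact: product_measure2E.
Qed.

Lemma measure_preserving_shear1 (a : R) :
  measure_preserving (leb2 R) (fun z : plane => (z.1 + a * z.2, z.2)).
Proof.
have ms : measurable_fun setT (fun z : plane => (z.1 + a * z.2, z.2) : plane).
  apply: (measurable_fun_pair (f := fun z : plane => z.1 + a * z.2 : R)) => //.
  by apply: measurable_funD => //; apply: measurable_funM.
split=> // A mA; rewrite !leb2_swapped// /product_measure2; last first.
  by rewrite -[X in measurable X]setTI; exact: ms.
apply: eq_integral => y _ /=.
rewrite -((measure_preserving_translation (a * y)).2 (ysection A y)) //.
exact: measurable_ysection.
Qed.

Definition rotation (p z : R * R) : R * R :=
  (z.1 * p.1 - z.2 * p.2, z.1 * p.2 + z.2 * p.1).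

(* A rotation by an angle other than pi is a product of three shears. *)
Lemma measure_preserving_rotation (p : R * R) : p.1 ^+ 2 + p.2 ^+ 2 = 1 ->
  measure_preserving (leb2 R) (rotation p : plane -> plane).
Proof.
have shears (q : R * R) : q.1 ^+ 2 + q.2 ^+ 2 = 1 -> q.1 != -1 ->
    measure_preserving (leb2 R) (rotation q : plane -> plane).
  case: q => c s /= cs c1; have c1' : 1 + c != 0 by rewrite addrC addr_eq0.
  (* For [c = cos theta] and [s = sin theta] this is [- tan (theta / 2)], the coefficient of the two
     outer shears. *)
  pose b := - s / (1 + c).
  rewrite (_ : rotation _ = (fun z : plane => (z.1 + b * z.2, z.2)) \o
    (fun z : plane => (z.1, z.2 + s * z.1)) \o
    (fun z : plane => (z.1 + b * z.2, z.2))).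
    by apply: measure_preserving_comp => //; first apply: measure_preserving_comp;
      [exact: measure_preserving_shear1|exact: measure_preserving_shear2|
       exact: measure_preserving_shear1].
  have s2 : s ^+ 2 = (1 - c) * (1 + c).
    by apply: (addrI (c ^+ 2)); rewrite cs; ring.
  have bs : b * s = c - 1.
    have -> : b * s = - s ^+ 2 / (1 + c) by rewrite /b; ring.
    by rewrite s2; field.
  have bc : b * (1 + c) = - s by rewrite /b; field.
  apply/funext => -[x y]; rewrite /rotation /=; congr pair.
    have -> : x + b * y + b * (y + s * (x + b * y)) =
      x * (1 + b * s) + y * (b * (2 + b * s)) by ring.
    by rewrite bs (_ : 2 + (c - 1) = 1 + c) ?bc; ring.
  have -> : y + s * (x + b * y) = x * s + y * (1 + b * s) by ring.
  by rewrite bs; ring.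
move=> p1; have [pN|] := eqVneq p.1 (-1); last exact: shears.
have p2 : p.2 = 0.
  move: p1; rewrite pN sqrrN expr1n -[RHS]addr0 => /addrI /eqP.
  by rewrite sqrf_eq0 => /eqP.
(* The half turn is the square of the quarter turn, to which [shears] applies. *)
rewrite (_ : rotation p = rotation (0, 1) \o rotation (0, 1)).
  by apply: measure_preserving_comp; apply: shears => /=;
    rewrite ?expr0n ?expr1n ?add0r// eq_sym oppr_eq0 oner_eq0.
by apply/funext => -[x y]; rewrite /rotation /= pN p2; congr pair; ring.
Qed.

End rotation.

(** Stated for [leb] itself, and for [leb2] below, so that [filterS] and its variants apply to their
    almost-everywhere statements. *)
Instance ae_leb_filter (R : realType) : Filter (almost_everywhere (leb R)).
Proof. exact: (ae_filter_ringOfSetsType (leb R)). Qed.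

Instance ae_leb2_filter (R : realType) : Filter (almost_everywhere (leb2 R)).
Proof. exact: (ae_filter_ringOfSetsType (leb2 R)). Qed.

(** * Linearity and invariance of the complex integral *)

Section complex_integral.
Context d (T : measurableType d) (R : realType).
Variable mu : {measure set T -> \bar R}.
Implicit Types (f g : T -> R[i]) (c : R[i]).

Definition Cintegrable f :=
  mu.-integrable setT (EFin \o (fun x => complex.Re (f x))) /\
  mu.-integrable setT (EFin \o (fun x => complex.Im (f x))).

Let integrable_comb (a b : R) (u v : T -> R) :
  mu.-integrable setT (EFin \o u) -> mu.-integrable setT (EFin \o v) ->
  mu.-integrable setT (EFin \o (fun x => a * u x + b * v x)) /\
  Rintegral mu setT (fun x => a * u x + b * v x) =
    a * Rintegral mu setT u + b * Rintegral mu setT v.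
Proof.
move=> iu iv.
have iau : mu.-integrable setT (EFin \o (fun x => a * u x)).
  exact: (integrableZl measurableT a iu).
have ibv : mu.-integrable setT (EFin \o (fun x => b * v x)).
  exact: (integrableZl measurableT b iv).
split; first exact: (integrableD measurableT iau ibv).
by rewrite RintegralD// !RintegralZl.
Qed.

(** The real and imaginary parts are real combinations of those of [f] and [g]; [integrable_comb] is
    applied twice to each, the second time with coefficients 1. *)
Lemma Cintegral_comb c f g : Cintegrable f -> Cintegrable g ->
  Cintegrable (fun x => c * f x + g x) /\
  Cintegral mu (fun x => c * f x + g x) = c * Cintegral mu f + Cintegral mu g.
Proof.
case: c => a b [fr fi] [gr gi].
have [r1 r2] := integrable_comb a (- b) fr fi.
have [r3 r4] := integrable_comb 1 1 r1 gr.
have [i1 i2] := integrable_comb a b fi fr.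
have [i3 i4] := integrable_comb 1 1 i1 gi.
have ReE x : complex.Re ((a +i* b)%C * f x + g x) =
    1 * (a * complex.Re (f x) + - b * complex.Im (f x)) + 1 * complex.Re (g x).
  by case: (f x) (g x) => ? ? [? ?] /=; ring.
have ImE x : complex.Im ((a +i* b)%C * f x + g x) =
    1 * (a * complex.Im (f x) + b * complex.Re (f x)) + 1 * complex.Im (g x).
  by case: (f x) (g x) => ? ? [? ?] /=; ring.
split.
  split; [move: r3|move: i3]; apply: eq_integrable => // x _ /=; congr EFin;
  by rewrite ?ReE ?ImE.
rewrite /Cintegral.
under eq_Rintegral do rewrite ReE.
under [X in (_ +i* X)%C]eq_Rintegral do rewrite ImE.
rewrite r4 r2 i4 i2; apply/eqP; rewrite eq_complex /=.
by apply/andP; split; apply/eqP; ring.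
Qed.

Lemma Cintegral_sum (I : Type) (s : seq I) (c : I -> R[i]) (F : I -> T -> R[i]) :
  (forall i, Cintegrable (F i)) ->
  Cintegrable (fun x => \sum_(i <- s) c i * F i x) /\
  Cintegral mu (fun x => \sum_(i <- s) c i * F i x) =
    \sum_(i <- s) c i * Cintegral mu (F i).
Proof.
move=> iF; elim: s => [|i s [IH1 IH2]].
  under [X in Cintegrable X]eq_fun do rewrite big_nil.
  under [X in Cintegral _ X]eq_fun do rewrite big_nil.
  rewrite big_nil; split; first by split; exact: integrable0.
  by rewrite /Cintegral /= /Rintegral !integral0.
have [H1 H2] := Cintegral_comb (c i) (iF i) IH1.
under [X in Cintegrable X]eq_fun do rewrite big_cons.
under [X in Cintegral _ X]eq_fun do rewrite big_cons.
by rewrite big_cons -IH2.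
Qed.

Lemma Cintegral_preserved (h : T -> T) f :
  measure_preserving mu h -> Cintegrable f ->
  Cintegrable (f \o h) /\ Cintegral mu (f \o h) = Cintegral mu f.
Proof.
move=> hp [fr fi]; split.
  by split; [have := measure_preserving_integrable hp fr|
             have := measure_preserving_integrable hp fi].
rewrite /Cintegral /Rintegral /=.
have /= -> := measure_preserving_integral hp fr.
by have /= -> := measure_preserving_integral hp fi.
Qed.

Lemma Cintegral_ae0 f : Cintegrable f -> {ae mu, forall x, f x = 0} ->
  Cintegral mu f = 0.
Proof.
move=> [/integrableP[mre _] /integrableP[mim _]] f0.
have re0 : (\int[mu]_x (complex.Re (f x))%:E = 0)%E.
  rewrite -[RHS](integral0 mu setT); apply: ae_eq_integral => //.
  by apply: filterS f0 => x ->.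
have im0 : (\int[mu]_x (complex.Im (f x))%:E = 0)%E.
  rewrite -[RHS](integral0 mu setT); apply: ae_eq_integral => //.
  by apply: filterS f0 => x ->.
by rewrite /Cintegral /Rintegral re0 im0.
Qed.

End complex_integral.

(** * Essential support and integrability *)

Section support.
Context (R : realType).
Local Notation plane := (measurableTypeR R * measurableTypeR R)%type.
Implicit Types f : R * R -> R[i].

(* The complement of the support is covered by the countably many rectangles
   with rational endpoints that meet [f != 0] in a null set. *)
Lemma ae_supp f : {ae leb2 R, forall x, f x != 0 -> supp f x}.
Proof.
pose rect (q : (rat * rat) * (rat * rat)) := [set x : R * R |
  (ratr q.1.1 < x.1 < ratr q.1.2) && (ratr q.2.1 < x.2 < ratr q.2.2)].
pose Z := [set y | f y != 0].
(* Rational rectangles are decoded from natural numbers; invalid codes, and rectangles meeting [Z]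
   in a non-null set, contribute [set0]. *)
pose F n := if @unpickle ((rat * rat) * (rat * rat))%type n is Some q then
  if `[< (leb2 R).-negligible (rect q `&` Z) >] then rect q `&` Z else set0
  else set0.
have F0 n : (leb2 R).-negligible (F n).
  rewrite /F; case: unpickle => [q|]; last exact: negligible_set0.
  by case: asboolP => // _; exact: negligible_set0.
apply: negligibleS (negligible_bigcup F0) => x /= /not_implyP[fx nsx].
have [U Ux NU] : exists2 U : set (R * R), nbhs x U & (leb2 R).-negligible (U `&` Z).
  apply/not_exists2P => H; apply: nsx => U Ux NU.
  by case: (H U).
move: Ux => /nbhs_ballP[e /= e0 xeU].
have [q1 /andP[]] := @rat_in_itvoo R (x.1 - e) x.1 ltac:(by rewrite ltrBlDr ltrDl).
rewrite !bnd_simp => l1 r1.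
have [q2 /andP[]] := @rat_in_itvoo R x.1 (x.1 + e) ltac:(by rewrite ltrDl).
rewrite !bnd_simp => l2 r2.
have [q3 /andP[]] := @rat_in_itvoo R (x.2 - e) x.2 ltac:(by rewrite ltrBlDr ltrDl).
rewrite !bnd_simp => l3 r3.
have [q4 /andP[]] := @rat_in_itvoo R x.2 (x.2 + e) ltac:(by rewrite ltrDl).
rewrite !bnd_simp => l4 r4.
pose q := ((q1, q2), (q3, q4)).
have rx : (rect q `&` Z) x by split => //; rewrite /rect /= r1 l2 r3 l4.
suff [n Fnx] : exists n, F n x by exists n.
exists (pickle q); rewrite /F pickleK; case: asboolP => // -[].
apply: negligibleS NU; apply: setSI => y /= /andP[/andP[y1 y2] /andP[y3 y4]].
apply: xeU; split; rewrite /ball /= ltr_distlC.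
  by apply/andP; split; lra.
by apply/andP; split; lra.
Qed.

(** Off the box [f] vanishes almost everywhere, and [r <= 1 + r ^+ 2] on it: the indicator of the
    box plus the squared modulus is an integrable majorant. *)
Lemma inL2_integrable f (a1 b1 a2 b2 : R) :
  inL2 f -> supp f `<=` box a1 b1 a2 b2 -> Cintegrable (leb2 R) f.
Proof.
move=> [mre mim f2] fbox.
pose B : set plane := `[a1, b1]%classic `*` `[a2, b2]%classic.
have mB : measurable B by exact: measurableX.
have Bfin : (leb2 R B < +oo)%E.
  have itv_fin (a b : R) : (leb R `[a, b]%classic < +oo)%E.
    rewrite /leb/= lebesgue_measure_itv/= -EFinB.
    by case: ifP => _; rewrite ltry.
  have -> : leb2 R B = (leb R `[a1, b1]%classic * leb R `[a2, b2]%classic)%E.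
    exact: product_measure1E.
  by rewrite lte_mul_pinfty// ge0_fin_numE.
have fB : {ae leb2 R, forall x, ~ B x -> f x = 0}.
  apply: filterS (ae_supp f) => x fx nBx; apply/eqP/negPn/negP => /fx /fbox [h1 h2].
  by apply: nBx; split; rewrite /= in_itv.
have main (u : plane -> R) : measurable_fun setT u ->
    (forall x, `|u x| <= cabs (f x)) -> (leb2 R).-integrable setT (EFin \o u).
  move=> mu uf; apply/integrableP; split; first exact/measurable_EFinP.
  have mf2 : measurable_fun setT (fun x : plane => cabs (f x) ^+ 2).
    have -> : (fun x : plane => cabs (f x) ^+ 2) = (fun x : plane =>
       complex.Re (f x) ^+ 2 + complex.Im (f x) ^+ 2).
      apply/funext => x; rewrite /cabs; case: (f x) => a b /=.
      by rewrite sqr_sqrtr// addr_ge0// sqr_ge0.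
    by apply: measurable_funD; apply: measurable_funX.
  pose v (x : plane) := (\1_B x + cabs (f x) ^+ 2).
  have mv : measurable_fun setT v by apply: measurable_funD.
  apply: (@le_lt_trans _ _ (\int[leb2 R]_x (v x)%:E)%E).
    apply: ae_ge0_le_integral => //.
    - by apply: measurableT_comp => //; exact/measurable_EFinP.
    - by move=> x _; rewrite lee_fin addr_ge0// ?sqr_ge0// indicE.
    - exact/measurable_EFinP.
    - apply: filterS fB => x fx _ /=; rewrite lee_fin.
      have [xB|xB] := pselect (B x); last first.
        rewrite (le_trans (uf x))// fx// /cabs /= expr0n /= addr0 sqrtr0.
        by rewrite addr_ge0// ?sqr_ge0.
      rewrite /v indicE mem_set// (le_trans (uf x))//.
      have : 0 <= cabs (f x) by rewrite /cabs; case: (f x) => *; exact: sqrtr_ge0.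
      move: (cabs _) => r r0; have := sqr_ge0 (r - 1); rewrite sqrrB1 /=; lra.
  rewrite (eq_integral (fun x => (\1_B x)%:E + (cabs (f x) ^+ 2)%:E)%E)//.
  rewrite ge0_integralD//; last 3 first.
  - exact/measurable_EFinP.
  - by move=> x _; rewrite lee_fin sqr_ge0.
  - exact/measurable_EFinP.
  by rewrite integral_indic// setIT lte_add_pinfty.
split; apply: main => // x; rewrite /cabs; case: (f x) => a b /=;
  by rewrite -sqrtr_sqr; apply: ler_wsqrtr; rewrite ?lerDl ?lerDr sqr_ge0.
Qed.

End support.

(** * Bases of subspaces and separating points *)

Section finite_dimensional_subspace.
Variables (F : fieldType) (n : nat).

Lemma rank_addsmx_gt m (u : 'rV[F]_n) (A : 'M[F]_(m, n)) :
  ~~ (u <= A)%MS -> (\rank A < \rank (u + A)%MS)%N.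
Proof.
move=> uA; suff : (A < u + A)%MS by rewrite ltmxErank => /andP[].
by rewrite ltmxE addsmxSr addsmx_sub negb_and uA.
Qed.

(** Among the matrices with all rows in [W], take one of maximal rank: a vector of [W] outside its
    row space would raise the rank. *)
Lemma subspace_row_basis (W : 'rV[F]_n -> Prop) :
  W 0 -> (forall a u v, W u -> W v -> W (a *: u + v)) ->
  exists A : 'M[F]_n, (forall i, W (row i A)) /\ forall u, W u -> (u <= A)%MS.
Proof.
move=> W0 WD.
have Wsub (A : 'M[F]_n) u : (forall i, W (row i A)) -> (u <= A)%MS -> W u.
  move=> WA /submxP[v ->]; rewrite mulmx_sum_row.
  elim/big_ind : _ => // [x y Wx Wy|i _]; first by rewrite -[x]scale1r; exact: WD.
  by rewrite -[X in W X]addr0; exact: WD.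
pose P r := `[< exists A : 'M[F]_n, (forall i, W (row i A)) /\ \rank A = r >].
have P0 : exists r, P r.
  exists 0%N; apply/asboolP; exists 0; split; last exact: mxrank0.
  by move=> i; rewrite row0.
have Pn r : P r -> (r <= n)%N by move=> /asboolP[A [_ <-]]; exact: rank_leq_row.
have [r /asboolP[A [WA <-]] rmax] := ex_maxnP P0 Pn.
exists A; split=> // u Wu; apply/negPn/negP => nuA.
have : P (\rank (u + A)%MS).
  apply/asboolP; exists (u + A)%MS; split=> // i.
  (* Each row of the sum is a multiple of [u] plus a vector of the row space of [A], hence lies in
     [W]. *)
  have /sub_addsmxP[[x y] ->] : (row i (u + A)%MS <= u + A)%MS by exact: row_sub.
  have -> : x *m u = x 0 0 *: u.
    by rewrite [x]mx11_scalar mul_scalar_mx mxE eqxx mulr1n.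
  by apply: WD => //; apply: Wsub WA _; exact: submxMl.
move=> /rmax; rewrite leqNgt => /negP; apply.
exact: rank_addsmx_gt.
Qed.

(** Greedy choice: if every [u y] with [y] in [D] lay in the row space of the [r < n] rows chosen so
    far, the columns of their cokernel would be killed by all of them, hence vanish, and the rank
    would be [n]. *)
Lemma separating_points (T : Type) (D : set T) (u : T -> 'rV[F]_n) :
  (forall c : 'cV[F]_n, (forall x, D x -> u x *m c = 0) -> c = 0) ->
  exists x : 'I_n -> T,
    (forall i, D (x i)) /\ row_free (\matrix_i u (x i)).
Proof.
move=> uD.
suff H r : (r <= n)%N -> exists x : 'I_r -> T,
    (forall i, D (x i)) /\ row_free (\matrix_i u (x i)) by exact: H.
elim: r => [_|r IHr rn].
  exists (fun i : 'I_0 => False_rect _ (notF (ltn_ord i))); split=> [[]//|];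
    by rewrite /row_free flatmx0 mxrank0.
have [x [Dx xfree]] := IHr (ltnW rn).
set A := \matrix_i u (x i) in xfree.
have [y Dy yA] : exists2 y, D y & ~~ (u y <= A)%MS.
  apply: contrapT => /forall2NP nD.
  have DA y : D y -> (u y <= A)%MS by move=> Dy; case: (nD y) => // /negP/negPn.
  have kA : cokermx A = 0.
    apply/matrixP => i j; rewrite [RHS]mxE.
    have := uD (col j (cokermx A)) _ => /(_ _)/colP/(_ i); rewrite !mxE; apply.
    move=> z Dz; have := DA z Dz; rewrite submxE => /eqP uz.
    by rewrite colE mulmxA uz mul0mx.
  have : \rank (cokermx A) = 0%N by rewrite kA mxrank0.
  rewrite mxrank_coker (eqP xfree) => /eqP; rewrite subn_eq0 leqNgt => /negP; exact.
exists (fun i : 'I_r.+1 => oapp x y (unlift ord0 i)); split.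
  by move=> i; case: unliftP => [j|] _ /=.
have -> : \matrix_i u (oapp x y (unlift ord0 i)) = col_mx (u y) A.
  apply/matrixP => i k; rewrite [LHS]mxE [RHS]mxE; case: splitP => j ij.
    have -> : i = ord0 by apply: val_inj; rewrite (ord1 j) in ij; exact: ij.
    by rewrite unlift_none (ord1 j).
  have -> : i = lift ord0 j by exact: val_inj.
  by rewrite liftK mxE.
have := rank_addsmx_gt yA; rewrite addsmxE (eqP xfree) => rk.
by rewrite /row_free eqn_leq rank_leq_row.
Qed.

End finite_dimensional_subspace.

(** * Continuous representatives and their linearity *)

Section continuous_representative.
Context (R : realType).
Implicit Types (g h : R -> R[i]) (c : R[i]).

(** If [u] and [v] differ at one point, they differ on a ball around it, which has positive
    measure. *)
Lemma continuous_ae_eq (u v : R -> R) : continuous u -> continuous v ->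
  {ae leb R, forall t, u t = v t} -> u = v.
Proof.
move=> cu cv uv; apply/funext => x; apply/eqP/negPn/negP => uvx.
have : \forall y \near x, u y - v y != 0.
  have : (u y - v y) @[y --> x] --> u x - v x by apply: cvgB; [exact: cu|exact: cv].
  move/cvgr_neq0; apply; by rewrite subr_eq0.
move=> /nbhs_ballP[e /= e0 xe].
have : (leb R).-negligible (ball x e : set (measurableTypeR R)).
  by apply: negligibleS uv => y /xe; rewrite /= subr_eq0 => /eqP.
move=> /negligibleP => /(_ (measurable_ball _ _)).
rewrite /leb/= lebesgue_measure_ball ?ltW//.
by move=> /eqP; rewrite eqe mulrn_eq0 /= gt_eqF.
Qed.

Lemma is_cont_rep_unique g h1 h2 :
  is_cont_rep g h1 -> is_cont_rep g h2 -> h1 = h2.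
Proof.
move=> [r1 i1 e1] [r2 i2 e2].
have e12 : {ae leb R, forall t, h1 t = h2 t}.
  by apply: filterS2 e1 e2 => t -> ->.
have er : (fun t => complex.Re (h1 t)) = (fun t => complex.Re (h2 t)).
  by apply: continuous_ae_eq => //; apply: filterS e12 => t ->.
have ei : (fun t => complex.Im (h1 t)) = (fun t => complex.Im (h2 t)).
  by apply: continuous_ae_eq => //; apply: filterS e12 => t ->.
apply/funext => t; apply/eqP; rewrite eq_complex.
by rewrite (congr1 (@^~ t) er) (congr1 (@^~ t) ei) !eqxx.
Qed.

Lemma is_cont_rep_comb c g1 g2 g h1 h2 : is_cont_rep g1 h1 -> is_cont_rep g2 h2 ->
  {ae leb R, forall t, g t = c * g1 t + g2 t} ->
  is_cont_rep g (fun t => c * h1 t + h2 t).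
Proof.
case: c => a b [r1 i1 e1] [r2 i2 e2] e; split.
- rewrite (_ : (fun t => _) = (fun t => a * complex.Re (h1 t)
    - b * complex.Im (h1 t) + complex.Re (h2 t))); last first.
    by apply/funext => t; case: (h1 t) (h2 t) => ? ? [? ?] /=.
  move=> t; apply: cvgD; last exact: r2.
  by apply: cvgB; apply: cvgM; [exact: cvg_cst|exact: r1|exact: cvg_cst|exact: i1].
- rewrite (_ : (fun t => _) = (fun t => a * complex.Im (h1 t)
    + b * complex.Re (h1 t) + complex.Im (h2 t))); last first.
    by apply/funext => t; case: (h1 t) (h2 t) => ? ? [? ?] /=.
  move=> t; apply: cvgD; last exact: i2.
  by apply: cvgD; apply: cvgM; [exact: cvg_cst|exact: i1|exact: cvg_cst|exact: r1].
- by apply: filterS3 e1 e2 e => t -> -> ->.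
Qed.

Lemma is_cont_rep0 g : {ae leb R, forall t, g t = 0} -> is_cont_rep g (fun=> 0).
Proof.
move=> g0; split; [exact: cst_continuous|exact: cst_continuous|].
by apply: filterS g0.
Qed.

(* The vectors [v] for which [S v] has a continuous representative form a
   subspace; the finitely many exceptional null sets of a basis serve for the
   whole subspace. *)
Lemma ae_cont_rep_linear n (S : 'rV[R[i]]_n -> R -> R[i]) (L : R -> 'cV[R[i]]_n) :
  {ae leb R, forall t, forall v, S v t = (v *m L t) 0 0} ->
  {ae leb R, forall t, forall v,
    xget (S v) [set h | is_cont_rep (S v) h] t = (v *m L t) 0 0}.
Proof.
move=> SL; pose W v := exists h, is_cont_rep (S v) h.
have W0 : W 0.
  exists (fun=> 0); apply: is_cont_rep0.
  by apply: filterS SL => t ->; rewrite mul0mx mxE.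
have WD a u v : W u -> W v -> W (a *: u + v).
  move=> [h1 uh1] [h2 vh2]; exists (fun t => a * h1 t + h2 t).
  apply: is_cont_rep_comb uh1 vh2 _; apply: filterS SL => t St.
  by rewrite !St mulmxDl -scalemxAl !mxE.
have [A [WA AW]] := subspace_row_basis W0 WD.
have [h hA] : exists h : 'I_n -> R -> R[i],
    forall i, is_cont_rep (S (row i A)) (h i).
  by exists (fun i => sval (cid (WA i))) => i; case: cid.
have hL : {ae leb R, forall t, forall i, h i t = (row i A *m L t) 0 0}.
  apply: filter_forall => i; have [_ _ e] := hA i.
  by apply: filterS2 SL e => t -> ->.
have rep (s : seq 'I_n) (v : 'I_n -> R[i]) :
    is_cont_rep (S (\sum_(i <- s) v i *: row i A))
      (fun t => \sum_(i <- s) v i * h i t).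
  elim: s => [|i s IH].
    under [X in is_cont_rep _ X]eq_fun do rewrite big_nil.
    rewrite big_nil; apply: is_cont_rep0.
    by apply: filterS SL => t ->; rewrite mul0mx mxE.
  under [X in is_cont_rep _ X]eq_fun do rewrite big_cons.
  rewrite big_cons; apply: is_cont_rep_comb (hA i) IH _.
  by apply: filterS SL => t St; rewrite !St mulmxDl -scalemxAl !mxE.
apply: filterS2 SL hL => t St ht v.
(* Without a continuous representative, [xget] returns its default [S v], for which the formula is
   [St]. *)
have [Wv|nWv] := pselect (W v); last first.
  by rewrite xgetPN// => h' vh'; apply: nWv; exists h'.
have /submxP[w vw] := AW v Wv; rewrite mulmx_sum_row in vw.
have vrep : is_cont_rep (S v) (xget (S v) [set h | is_cont_rep (S v) h]).
  exact: xgetPex.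
have wrep : is_cont_rep (S v) (fun t => \sum_i w 0 i * h i t) by rewrite vw.
(* Uniqueness gives equality of the representatives at every point, so no null set depending on [v]
   appears. *)
rewrite (is_cont_rep_unique vrep wrep) vw mulmx_suml summxE; apply: eq_bigr => i _.
by rewrite ht -scalemxAl [RHS]mxE.
Qed.

End continuous_representative.

(** * Linear independence of translates on the line *)

Section translates.
Context (R : realType).

Lemma ae_translate (P : R -> Prop) (a : R) :
  {ae leb R, forall x, P x} -> {ae leb R, forall x, P (x + a)}.
Proof. exact: (measure_preserving_ae (measure_preserving_translation a)). Qed.

(* The leftmost translate of a linear relation is not hit by the others just
   after the left end of the support of [g]. *)
Lemma translates_independent n (g : R -> R[i]) (t : 'I_n -> R)
    (c : 'I_n -> R[i]) (a : R) : injective t ->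
  {ae leb R, forall x, x < a -> g x = 0} ->
  ~ {ae leb R, forall x, g x = 0} ->
  {ae leb R, forall x, \sum_i c i * g (x - t i) = 0} ->
  forall i, c i = 0.
Proof.
move=> t_inj ga gn0 rel i; apply/eqP/negPn/negP => ci; apply: gn0.
have [k ck kmin] := @arg_minP _ _ _ i (fun j => c j != 0) t ci.
have [d d0 dt] : exists2 d, 0 < d & forall j, c j != 0 -> j != k -> t k + d <= t j.
  (* The smallest gap between the leftmost active shift [t k] and the other active ones; the 1 keeps
     it positive when there are none. *)
  exists (\big[Order.min/1]_(j | (c j != 0) && (j != k)) (t j - t k)).
    apply: lt_bigmin => // j /andP[cj jk]; rewrite subr_gt0 lt_neqAle kmin// andbT.
    by apply: contra jk => /eqP /t_inj ->.
  move=> j cj jk; rewrite -lerBrDl; apply: bigmin_le_cond.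
  by rewrite cj jk.
(* The relation is read at [x + t k]: for [x < b + d] every other active translate is evaluated to
   the left of [b], so only [c k * g x] remains. *)
have step b : {ae leb R, forall x, x < b -> g x = 0} ->
    {ae leb R, forall x, x < b + d -> g x = 0}.
  move=> gb.
  have others : {ae leb R, forall x, forall j,
      x + (t k - t j) < b -> g (x + (t k - t j)) = 0}.
    by apply: filter_forall => j; exact: (ae_translate (t k - t j) gb).
  apply: filterS2 (ae_translate (t k) rel) others => x relx ox xb.
  move: relx; rewrite (bigD1 k)//= big1 ?addr0; last first.
    move=> j jk; have [->|cj] := eqVneq (c j) 0; first by rewrite mul0r.
    rewrite -addrA ox ?mulr0//.
    by have := dt _ cj jk; lra.
  by rewrite addrK => /eqP; rewrite mulf_eq0 (negbTE ck) => /eqP.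
have far m : {ae leb R, forall x, x < a + d *+ m -> g x = 0}.
  elim: m => [|m IH]; first by rewrite mulr0n addr0.
  by rewrite mulrSr addrA; exact: step.
apply: filterS (ae_foralln far) => x gx.
(* This many steps of length [d] lead from [a] past [x]. *)
apply: (gx (Num.truncn ((x - a) / d)).+1).
by rewrite -ltrBlDl -mulr_natl -ltr_pdivrMr// truncnS_gt.
Qed.

End translates.

(** * The Radon transform of [phi] and of its shifts *)

Section radon.
Context (R : realType).
Local Notation plane := (measurableTypeR R * measurableTypeR R)%type.

(** By Tonelli the measures of the sections of a null set integrate to 0, so almost every section is
    null. *)
Lemma ae_leb2_iterated (P : R * R -> Prop) :
  {ae leb2 R, forall z, P z} ->
  {ae leb R, forall x, {ae leb R, forall y, P (x, y)}}.
Proof.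
move=> [A [mA A0 PA]].
have mxA : measurable_fun setT
    ((leb R : set (measurableTypeR R) -> \bar R) \o xsection A).
  exact: measurable_fun_xsection.
have : (\int[leb R]_x `|(leb R \o xsection A) x| = 0)%E.
  by rewrite -[RHS]A0; apply: eq_integral => x _; rewrite gee0_abs.
move=> /(ae_eq_integral_abs (leb R) measurableT mxA).
apply: filterS => x /(_ I) /= xA0; exists (xsection A x); split => //.
  exact: measurable_xsection.
by move=> y nP; rewrite /xsection /= inE; exact: PA.
Qed.

Variables (phi : R * R -> R[i]) (N1 M1 N2 M2 : R) (p : R * R).
Hypotheses (phi_L2 : inL2 phi) (phi_supp : supp phi `<=` box N1 M1 N2 M2).
Hypothesis p_unit : p.1 ^+ 2 + p.2 ^+ 2 = 1.

Let rot_preserving := measure_preserving_rotation p_unit.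

Let phi_int : Cintegrable (leb2 R) phi.
Proof. exact: inL2_integrable phi_L2 phi_supp. Qed.

Let phi_rot_int : Cintegrable (leb2 R) (phi \o rotation p).
Proof. by have [] := Cintegral_preserved rot_preserving phi_int. Qed.

Lemma ae_Cintegrable_slice :
  {ae leb R, forall t, Cintegrable (leb R) (fun s => phi (rotation p (t, s)))}.
Proof.
case: phi_rot_int => re im.
have := ae_integrable1 im; have := ae_integrable1 re.
by apply: filterS2 => t ? ?; split.
Qed.

(** In rotated coordinates a shift by [z i] moves the line offset by [dot2 p (z i)] and the
    parameter along the line by [b i]. The coefficients are quantified inside, so that one null set
    serves all of them. *)
Lemma ae_radon_lincomb n (z : 'I_n -> R * R) :
  {ae leb R, forall t, forall c : 'I_n -> R[i],
    radon p (fun x => \sum_i c i * phi (x - z i)) t =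
    \sum_i c i * radon p phi (t - dot2 p (z i))}.
Proof.
have : {ae leb R, forall t, forall i, Cintegrable (leb R)
    (fun s => phi (rotation p (t + - dot2 p (z i), s)))}.
  apply: filter_forall => i.
  exact: (ae_translate (- dot2 p (z i)) ae_Cintegrable_slice).
apply: filterS => t int_t c.
pose b i := - (z i).1 * p.2 + (z i).2 * p.1.
have rotB i s : rotation p (t, s) - z i = rotation p (t - dot2 p (z i), s - b i).
  rewrite /rotation /dot2 /b /=; case: (z i) => z1 z2 /=; congr pair => /=.
    have := congr1 ( *%R z1) p_unit; rewrite mulr1 => {1}<-; ring.
  have := congr1 ( *%R z2) p_unit; rewrite mulr1 => {1}<-; ring.
have shifted i :=
  Cintegral_preserved (measure_preserving_translation (- b i)) (int_t i).
rewrite /radon.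
have := Cintegral_sum (mu := leb R) (index_enum 'I_n) c
  (F := fun i s => phi (rotation p (t - dot2 p (z i), s - b i)))
  (fun i => (shifted i).1).
move=> [_ E].
transitivity (Cintegral (leb R) (fun s => \sum_i c i *
  phi (rotation p (t - dot2 p (z i), s - b i)))).
  congr (Cintegral _ _); apply/funext => s; apply: eq_bigr => i _.
  by rewrite -rotB.
rewrite E; apply: eq_bigr => i _; congr (_ * _).
exact: (shifted i).2.
Qed.

(** A point [z] of the line at offset [t] satisfies [dot2 p z = t], and both coordinates of [p] are
    at most 1 in modulus; lines far to the left therefore miss the box. *)
Lemma radon_eq0_left :
  {ae leb R, forall t, t < - (`|N1| + `|M1| + `|N2| + `|M2|) -> radon p phi t = 0}.
Proof.
have := ae_leb2_iterated (measure_preserving_ae rot_preserving (ae_supp phi)).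
apply: filterS2 ae_Cintegrable_slice => t int_t supp_t t_lt.
apply: Cintegral_ae0 int_t _; apply: filterS supp_t => s suppP.
apply/eqP/negPn/negP => /suppP /phi_supp.
set z := rotation p (t, s) => -[z1 z2].
have tE : t = z.1 * p.1 + z.2 * p.2.
  by rewrite -[LHS]mulr1 -p_unit /z /rotation /=; ring.
have p1 : `|p.1| <= 1.
  by rewrite -(@ler_pXn2r _ 2)// ?nnegrE// real_normK ?num_real//
    expr1n -p_unit lerDl sqr_ge0.
have p2 : `|p.2| <= 1.
  by rewrite -(@ler_pXn2r _ 2)// ?nnegrE// real_normK ?num_real//
    expr1n -p_unit lerDr sqr_ge0.
have norm_itv (a b x : R) : a <= x <= b -> `|x| <= `|a| + `|b|.
  move=> /andP[ax xb]; have := ler_norm (- a); have := ler_norm b.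
  have := normr_ge0 a; have := normr_ge0 b; rewrite normrN ler_norml => ? ? ? ?.
  by apply/andP; split; lra.
move: t_lt; apply/negP; rewrite -leNgt lerNl -addrA.
apply: le_trans (lerD (norm_itv _ _ _ z1) (norm_itv _ _ _ z2)).
have bound (x y : R) : `|y| <= 1 -> - (x * y) <= `|x|.
  move=> y1; rewrite (le_trans (ler_norm _))// normrN normrM -[leRHS]mulr1.
  exact: ler_wpM2l.
by rewrite tE opprD lerD ?bound.
Qed.

(** By rotation invariance and Fubini, the integral of the Radon transform over all offsets is the
    integral of [phi], that is [fourier2 phi 0]. *)
Lemma radon_not_ae0 : fourier2 phi 0 != 0 ->
  ~ {ae leb R, forall t, radon p phi t = 0}.
Proof.
move=> hat0 r0; case/negP: hat0.
have -> : fourier2 phi 0 = Cintegral (leb2 R) (phi \o rotation p).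
  have [_ ->] := Cintegral_preserved rot_preserving phi_int.
  congr (Cintegral _ _); apply/funext => x.
  rewrite /expi /dot2 /= !mulr0 addr0 oppr0 cos0 sin0.
  exact: mulr1.
have slice0 (u : plane -> R) : (leb2 R).-integrable setT (EFin \o u) ->
    {ae leb R, forall t, Rintegral (leb R) setT (fun s => u (t, s)) = 0} ->
    Rintegral (leb2 R) setT u = 0.
  move=> iu u0; rewrite /Rintegral -(integral12_prod_meas1 iu).
  rewrite (_ : integral _ _ _ = 0%E)// -[RHS](integral0 (leb R) setT).
  apply: ae_eq_integral => //; first exact: (measurable_fubini_F iu).
  (* [Rintegral] also reads 0 on an infinite integral; almost every slice integral is finite, so its
     vanishing lifts to the extended reals. *)
  have := integrable_ae measurableT (integrable_fubini_F iu).
  apply: filterS2 u0 => t + /(_ I) ut => + _.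
  by rewrite /Rintegral => ut0; rewrite -[LHS](fineK ut) [X in X%:E]ut0.
have [re im] := phi_rot_int.
apply/eqP; rewrite /Cintegral; congr (_ +i* _)%C; apply: slice0 => //;
  by apply: filterS r0 => t [].
Qed.

End radon.

(** * Enumeration of [E] and the condition on the direction *)

Lemma finite_set_enum (T : choiceType) (A : set T) : finite_set A ->
  exists (n : nat) (tau : 'I_n -> T), [/\ injective tau, range tau = A &
    forall (V : nmodType) (F : T -> V), \sum_(k \in A) F k = \sum_i F (tau i)].
Proof.
move=> Afin; set s := finmap.enum_fset (fset_set A).
have s_uniq : uniq s by exact: finmap.fset_uniq.
have sA x : (x \in s) = (x \in A) by rewrite -(in_fset_set Afin).
exists (size s), (tnth (in_tuple s)); split.
- by apply/tuple_uniqP.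
- apply/seteqP; split=> [_ [i _ <-]|x /mem_set].
    by apply: set_mem; rewrite -sA mem_tnth.
  by rewrite -sA => /(tnthP (in_tuple s))[i ->]; exists i.
- by move=> V F; rewrite fsbig_finite//= -/s big_tnth.
Qed.

Lemma Eset_finite (R : realType) (N1 M1 N2 M2 a1 b1 a2 b2 : R) :
  finite_set (Eset N1 M1 N2 M2 a1 b1 a2 b2).
Proof.
have itv_fin (a b : int) : finite_set [set k : int | a <= k <= b].
  apply: (@sub_finite_set _ _ [set` [seq a + i%:Z | i <- iota 0 `|b - a|%N.+1]]).
    move=> k /andP[ak kb]; rewrite /mkset; apply/mapP; exists `|k - a|%N.
      by rewrite mem_iota; lia.
    lia.
  exact: finite_seq.
apply: sub_finite_set (finite_setX
  (itv_fin (Num.ceil (a1 - M1)) (Num.floor (b1 - N1)))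
  (itv_fin (Num.ceil (a2 - M2)) (Num.floor (b2 - N2)))).
by move=> k [].
Qed.

Lemma zpt_inj (R : realType) : injective (@zpt R).
Proof. by move=> [k1 k2] [l1 l2] [/intr_inj -> /intr_inj ->]. Qed.

(** If distinct points of [E] had equal products with [p], their difference in [Eplus E] would be
    orthogonal to [p]; then [p] would lie in the null set and, being a unit vector, be its own
    direction. *)
Lemma dirs_dot2_inj (R : realType) (E : set (int * int)) (p : R * R) :
  (@dirs R `\` dv (nullset (Eplus E))) p ->
  p.1 ^+ 2 + p.2 ^+ 2 = 1 /\
  forall k l, E k -> E l -> dot2 p (zpt R k) = dot2 p (zpt R l) -> k = l.
Proof.
move=> [[theta _ ->] np]; split; first by rewrite /= cos2Dsin2.
move=> k l Ek El kl; apply: contrapT => nkl; apply: np.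
have p1 : norm2 (cos theta, sin theta) = 1 by rewrite /norm2 /= cos2Dsin2 sqrtr1.
have p0 : (cos theta, sin theta) != 0.
  apply/eqP => p0; move: p1; rewrite p0 /norm2 /= expr0n addr0 sqrtr0 => /eqP.
  by rewrite eq_sym oner_eq0.
exists theta, (cos theta, sin theta); split => //; last by rewrite p1 !mul1r.
split => //; exists (zpt R k - zpt R l); split; first by exists k, l.
  by rewrite subr_eq0; apply: contra_not_neq nkl; exact: zpt_inj.
by move: kl; rewrite /dot2 /=; lra.
Qed.

(** * The invertible sampling matrix and the recovery of the coefficients *)

Unset Implicit Arguments.

Theorem theorem4p3 (R : realType) (phi : R * R -> R[i])
    (N1 M1 N2 M2 a1 b1 a2 b2 : R)
    (phi_L2 : inL2 phi)
    (phi_supp : supp phi `<=` box N1 M1 N2 M2)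
    (phi_indep : shifts_independent phi)
    (phi_smooth : ((1 / 2)%:E < nu2 phi)%E)
    (phi_hat0 : fourier2 phi 0 != 0) :
  let E := Eset N1 M1 N2 M2 a1 b1 a2 b2 in
  forall p : R * R, (@dirs R `\` dv (nullset (Eplus E))) p ->
  exists X : set R, (X #= E)%card /\
    forall f : R * R -> R[i], target phi E a1 b1 a2 b2 f ->
      determined phi E p X f.
Proof.
move=> E p /dirs_dot2_inj[p_unit dot_inj].
have [n [tau [tau_inj tauE sumE]]] :=
  finite_set_enum (Eset_finite N1 M1 N2 M2 a1 b1 a2 b2).
rewrite -/E in tauE sumE.
have E_tau i : E (tau i) by rewrite -tauE; exists i.
pose S (v : 'rV[R[i]]_n) :=
  radon p (fun x => \sum_i v 0 i * phi (x - zpt R (tau i))).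
pose t i := dot2 p (zpt R (tau i)).
pose L x : 'cV[R[i]]_n := \col_i radon p phi (x - t i).
have zcombE c : radon p (zcomb E c phi) = S (\row_i c (tau i)).
  congr radon; apply/funext => x; rewrite /zcomb sumE.
  by apply: eq_bigr => i _; rewrite mxE.
have SL : {ae leb R, forall x, forall v, S v x = (v *m L x) 0 0}.
  have := ae_radon_lincomb phi_L2 phi_supp p_unit (fun i => zpt R (tau i)).
  apply: filterS => x Sx v.
  by rewrite /S Sx mxE; apply: eq_bigr => i _; rewrite mxE.
have sampleL := ae_cont_rep_linear SL.
(* A set of full measure that depends on neither [f] nor its coefficients; on it all samples are
   linear in the coefficient vector. *)
pose D := [set x | forall v,
  xget (S v) [set h | is_cont_rep (S v) h] x = (v *m L x) 0 0].
(* A column killed by all rows [(L x)^T] with [x] in [D] is an almost-everywhere relation between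
   translates of [radon p phi], hence zero. *)
have [|x [Dx xfree]] := @separating_points _ n R D (fun x => (L x)^T).
  move=> c Lc; apply/colP => i; rewrite [RHS]mxE.
  apply: (translates_independent (g := radon p phi) (t := t) (c := fun j => c j 0)
    (a := - (`|N1| + `|M1| + `|N2| + `|M2|))).
  - by move=> j l /(dot_inj _ _ (E_tau j) (E_tau l))/tau_inj.
  - exact: radon_eq0_left phi_L2 phi_supp p_unit.
  - exact: radon_not_ae0 phi_L2 phi_supp p_unit phi_hat0.
  - apply: filterS sampleL => y /Lc /matrixP/(_ 0 0); rewrite !mxE => yc.
    by rewrite -[RHS]yc; apply: eq_bigr => j _; rewrite !mxE mulrC.
(* Equal points would give equal rows of a matrix with a right inverse; injectivity yields the
   cardinality of [X]. *)
have x_inj : injective x.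
  move=> i j xij; move: xfree => /row_freeP[B AB].
  have /matrixP/(_ i j) := AB; have /matrixP/(_ j j) := AB.
  rewrite !mxE eqxx; under eq_bigr do rewrite !mxE -xij.
  under [X in _ -> X = _ -> _]eq_bigr do rewrite !mxE.
  by move=> ->; case: (eqVneq i j) => // _ /eqP; rewrite oner_eq0.
exists (range x); split.
  have rangeI (T : choiceType) (h : 'I_n -> T) : injective h ->
    (range h #= [set: 'I_n])%card by move=> h_inj; apply: inj_card_eq; exact: in2W.
  apply: card_eq_trans (rangeI _ _ x_inj) _.
  by rewrite -tauE card_eq_sym; exact: rangeI.
move=> f [_ _ [c ->]] d same.
apply/funext => y; rewrite /zcomb !sumE; apply: eq_bigr => i _; congr (_ * _).
pose v (e : int * int -> R[i]) := \row_i e (tau i).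
suff : v d = v c by move=> /rowP/(_ i); rewrite !mxE.
apply/eqP; rewrite -subr_eq0 -(inj_eq trmx_inj) trmx0; apply/eqP.
set M := \matrix_i (L (x i))^T in xfree.
(* Entry [j] of this product is the difference of the two samples at [x j]. *)
have: M *m (v d - v c)^T = 0.
  apply/row_matrixP => j; rewrite row_mul rowK row0.
  rewrite -trmx_mul mulmxBl; apply/matrixP => k l.
  rewrite !ord1 2![in LHS]mxE [RHS]mxE.
  have := same (x j) ltac:(by exists j); rewrite /radon_sample !zcombE.
  by rewrite !(Dx j) => ->; rewrite [X in _ + X]mxE subrr.
move: xfree; rewrite row_free_unit => xunit /(congr1 (mulmx (invmx M))).
by rewrite mulKmx// mulmx0.
Qed.
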